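(* A randomized exact equilibrium strategy may fail to exist: there exist a Polish space $\mathbb{X}$, a transition kernel $\Pi$ on $\mathbb{X}$ admitting densities with respect to a common reference probability measure, bounded Borel payoff functions $f_i,g_i,h_i:\mathbb{X}\to\mathbb{R}$ ($i=1,2$) and discount factors $\delta_1,\delta_2\in(0,1)$ for which no $p\in\mathcal{R}_0$ is a randomized exact equilibrium strategy, i.e. there is no $p\in\mathcal{R}_0$ with $$V(x,p)\ge V(x,p'\oplus_1p)\quad\text{for all }x\in\mathbb{X},\ p'\in\mathcal{R}_0.$$
   Context: $X=(X_t)_{t\ge0}$ is a time-homogeneous Markov chain on $\mathbb{X}$ with kernel $\Pi$; $\mathbb{E}_x$ is expectation given $X_0=x$. $\mathcal{R}_0$ is the set of Borel functions $p:\mathbb{X}\to[0,1]$ (randomized Markov stopping policies; $p_x$ is the probability of stopping at the current time when the current state is $x$). $Y,Y'$ are independent i.i.d. uniform $[0,1]$ sequences independent of $X$. The leader using $p$ stops at $\tau^p=\inf\{t\ge0:Y_t\le p_{X_t}\}$; the follower using $(r,q)\in\mathcal{R}_0^2$ stops at $\tau^{r,q}=\inf\{t\ge0:Y'_t\le r_{X_t}1_{\{\tau^p\le t\}}+q_{X_t}1_{\{\tau^p>t\}}\}$. With $F_1(\tau,\rho)=f_1(X_\tau)1_{\{\tau<\rho\}}+g_1(X_\rho)1_{\{\rho<\tau\}}+h_1(X_\tau)1_{\{\rho=\tau\}}$, set $J_1(x,p,(r,q))=\mathbb{E}_x[\delta_1^{\tau^p\wedge\tau^{r,q}}F_1(\tau^p,\tau^{r,q})]$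 (zero payoff if nobody stops). The follower (payoff $f_2$ if he stops first, $g_2$ if the leader stops first, $h_2$ if they stop simultaneously, discount $\delta_2$) responds to $p$ with his earliest optimal response $r^*_x=1_{\{h_2(x)\ge g_2(x)\}}$, $q^*_x(p)=1_{\{f_2(x)\ge W_C(x,p)\}}$, where $W_S(x)=\max\{h_2(x),g_2(x)\}$ and $W_C(\cdot,p)$ is the bounded solution of $$W_C(x,p)=\max\Big\{f_2(x),\ \delta_2\int_{\mathbb{X}}[p_yW_S(y)+(1-p_y)W_C(y,p)]\,\Pi(x,dy)\Big\}.$$ The leader's value is $V(x,p)=J_1(x,p,(r^*,q^*(p)))=p_xV_S(x)+(1-p_x)V_C(x,p)$, where $V_S(x)=r^*_xh_1(x)+(1-r^*_x)f_1(x)$ and $V_C(x,p)=q^*_x(p)g_1(x)+(1-q^*_x(p))\delta_1\mathbb{E}_x[V(X_1,p)]$. For $p'\in\mathcal{R}_0$, $p'\oplus_1p$ denotes using $p'$ at the first step and $p$ afterwards; the follower's response in the case where the leader continues at the current step depends only on the leader's future strategy, so $V(x,p'\oplus_1p)=p'_xV_S(x)+(1-p'_x)V_C(x,p)$. *)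

(* Defs.v *)
From HB Require Import structures.
From mathcomp Require Import all_boot all_order all_algebra.
From mathcomp Require Import all_classical all_reals all_analysis.

Set Implicit Arguments.
Unset Strict Implicit.
Unset Printing Implicit Defensive.

Import Order.TTheory GRing.Theory Num.Theory.
Import numFieldNormedType.Exports.

Local Open Scope classical_set_scope.
Local Open Scope ring_scope.

Notation borel X := (g_sigma_algebraType (@open X)).

Definition separable (T : topologicalType) : Prop :=
  exists2 D : set T, countable D & dense D.

(* A Hausdorff pseudometric space is a metric space. *)
Definition polish (R : realType) (X : completePseudoMetricType R) : Prop :=
  hausdorff_space X /\ separable X.

Definition bounded_borel (R : realType) (X : ptopologicalType) (f : X -> R) :
    Prop :=
  [bounded f x | x in [set: X]] /\ measurable_fun setT (f : borel X -> R).

Definition has_densities (R : realType) (X : ptopologicalType)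
    (Pi : R.-pker (borel X) ~> (borel X)) : Prop :=
  exists (mu : probability (borel X) R) (k : X * X -> R),
    [/\ measurable_fun setT (k : borel X * borel X -> R),
        forall z, 0 <= k z &
        forall (x : X) (A : set (borel X)), measurable A ->
          Pi x A = (\int[mu]_(y in A) (k (x, y))%:E)%E].

Definition mutually_independent d (Omega : measurableType d) (R : realType)
    (P : probability Omega R) (I : eqType) (F : I -> set_system Omega) : Prop :=
  forall (J : seq I) (A : I -> set Omega), uniq J ->
    (forall i, i \in J -> F i (A i)) ->
    P (\bigcap_(i in [set` J]) A i) = (\prod_(i <- J) P (A i))%E.

(* P x is the law under which the chain starts at x; Y and Y' are the
   randomization devices of the leader and of the follower. *)
Section randomized_chain.
Context (R : realType) (X : ptopologicalType).
Context (Pi : R.-pker (borel X) ~> (borel X)).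
Context d (Omega : measurableType d) (P : X -> probability Omega R).
Context (Xt : nat -> Omega -> X) (Y Y' : nat -> Omega -> R).

Definition sigma_upto (D : set nat) : set_system Omega :=
  <<s \bigcup_(t in D)
        preimage_set_system setT (Xt t : Omega -> borel X) measurable >>.

Definition is_markov_chain : Prop :=
  [/\ forall t, measurable_fun setT (Xt t : Omega -> borel X),
      forall x, {ae P x, forall w, Xt 0%N w = x} &
      forall x t (E : set Omega) (B : set (borel X)),
        sigma_upto `I_t.+1 E -> measurable B ->
        P x (E `&` Xt t.+1 @^-1` B) = (\int[P x]_(w in E) Pi (Xt t w) B)%E].

Definition is_uniform01 (U : Omega -> R) : Prop :=
  measurable_fun setT U /\
  forall x (A : set R), measurable A ->
    P x (U @^-1` A) = uniform_prob (@ltr01 R) A.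

(* None is the whole chain; Some (b, t) is Y_t if b = false and Y'_t if
   b = true. *)
Definition noise_source (i : option (bool * nat)) : set_system Omega :=
  match i with
  | None => sigma_upto setT
  | Some (false, t) => preimage_set_system setT (Y t) measurable
  | Some (true, t) => preimage_set_system setT (Y' t) measurable
  end.

Definition randomized_chain : Prop :=
  [/\ is_markov_chain,
      forall t, is_uniform01 (Y t),
      forall t, is_uniform01 (Y' t) &
      forall x, mutually_independent (P x) noise_source].

End randomized_chain.

(* A player's payoffs when he stops first, when the opponent stops first, and
   when both stop simultaneously, i.e. (f_i, g_i, h_i), and his discount
   factor delta_i. *)
Record player (R : realType) (X : Type) := Player {
  first_payoff : X -> R;
  second_payoff : X -> R;
  tie_payoff : X -> R;
  discount : R }.

Definition admissible_player (R : realType) (X : ptopologicalType)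
    (a : player R X) : Prop :=
  [/\ bounded_borel (first_payoff a), bounded_borel (second_payoff a),
      bounded_borel (tie_payoff a) & 0 < discount a < 1].

(* The set R_0 of randomized Markov stopping policies. *)
Definition markov_policy (R : realType) (X : ptopologicalType) (p : X -> R) :
    Prop :=
  measurable_fun setT (p : borel X -> R) /\ forall x, 0 <= p x <= 1.

(* The infimum of a set of times, None standing for +oo. *)
Definition first_time (a : pred nat) : option nat :=
  if pselect (exists n, a n) is left ex_a then Some (ex_minn ex_a) else None.

Definition reached (tau : option nat) (t : nat) : bool :=
  if tau is Some s then (s <= t)%N else false.

(* The policy sequence p' (+)_1 p: p' at time 0 and p at all later times. *)
Definition concat1 (R : realType) (X : Type) (p' p : X -> R) :
    nat -> X -> R :=
  fun t => if t is 0%N then p' else p.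

Section game.
Context (R : realType) (X : ptopologicalType).
Context (Pi : R.-pker (borel X) ~> (borel X)).
Context d (Omega : measurableType d) (P : X -> probability Omega R).
Context (Xt : nat -> Omega -> X) (Y Y' : nat -> Omega -> R).
Context (leader follower : player R X).

Local Notation f1 := (first_payoff leader).
Local Notation g1 := (second_payoff leader).
Local Notation h1 := (tie_payoff leader).
Local Notation delta1 := (discount leader).
Local Notation f2 := (first_payoff follower).
Local Notation g2 := (second_payoff follower).
Local Notation h2 := (tie_payoff follower).
Local Notation delta2 := (discount follower).

(* The leader may use a different policy s t at each time t, so as to cover
   p' (+)_1 p; a policy p in R_0 is the constant sequence. *)
Definition leader_time (s : nat -> X -> R) (w : Omega) : option nat :=
  first_time (fun t => Y t w <= s t (Xt t w)).

Definition follower_time (s : nat -> X -> R) (r q : X -> R) (w : Omega) :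
    option nat :=
  first_time (fun t => Y' t w <=
    if reached (leader_time s w) t then r (Xt t w) else q (Xt t w)).

Definition leader_payoff (tau rho : option nat) (w : Omega) : R :=
  match tau, rho with
  | Some t, Some u =>
      delta1 ^+ minn t u *
      (if (t < u)%N then f1 (Xt t w)
       else if (u < t)%N then g1 (Xt u w) else h1 (Xt t w))
  | Some t, None => delta1 ^+ t * f1 (Xt t w)
  | None, Some u => delta1 ^+ u * g1 (Xt u w)
  | None, None => 0
  end.

Definition J1 (x : X) (s : nat -> X -> R) (r q : X -> R) : R :=
  \int[P x]_w leader_payoff (leader_time s w) (follower_time s r q w) w.

Definition W_S (x : X) : R := Num.max (h2 x) (g2 x).

Definition solves_W_C (p W : X -> R) : Prop :=
  bounded_borel W /\
  forall x, W x = Num.max (f2 x)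
    (delta2 * \int[Pi x]_y (p y * W_S y + (1 - p y) * W y)).

(* For p in R_0 and delta2 in (0, 1) the solution exists and is unique by the
   contraction principle. *)
Definition W_C (p : X -> R) : X -> R :=
  xget (fun=> 0) [set W | solves_W_C p W].

Definition r_star (x : X) : R := if g2 x <= h2 x then 1 else 0.

Definition q_star (p : X -> R) (x : X) : R := if W_C p x <= f2 x then 1 else 0.

Definition V (x : X) (p : X -> R) : R := J1 x (fun=> p) r_star (q_star p).

(* V(x, p' (+)_1 p): the response to continuation at time 0 depends only on the
   leader's future policy, so it is q_star p at time 0 as well as later. *)
Definition V_concat1 (x : X) (p' p : X -> R) : R :=
  J1 x (concat1 p' p) r_star (q_star p).

Definition randomized_exact_equilibrium (p : X -> R) : Prop :=
  markov_policy p /\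
  forall (x : X) (p' : X -> R), markov_policy p' -> V_concat1 x p' p <= V x p.

End game.

(* Main.v *)
Require Import Defs.
From mathcomp Require Import all_boot all_order all_algebra.
From mathcomp Require Import all_classical all_reals all_analysis.
From mathcomp Require Import measurable_realfun ring lra.

(* One state suffices. Take f_1 = h_1 = -1, g_1 = -2, f_2 = 0, g_2 = h_2 = 1
   and both discount factors 1/2. If p = 0, waiting is worthless to the
   follower (W_C = 0 = f_2), so he stops at once and the leader gets -2,
   although stopping himself would give him -1. If p > 0, waiting has positive
   value, so the follower only stops together with the leader, whose payoff is
   -E[2^-tau]; postponing his stop by one period is then strictly better.

   The i.i.d. uniform variables live on [0, 1]: a uniform w has i.i.d. fair
   binary digits, its even and odd digits form two independent uniform numbers
   a(w) and S(w), and a(w), a(S(w)), a(S(S(w))), ... are i.i.d. uniform. *)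

Set Implicit Arguments.
Unset Strict Implicit.
Unset Printing Implicit Defensive.

Import Order.TTheory GRing.Theory Num.Theory.
Import numFieldNormedType.Exports.

Local Open Scope classical_set_scope.
Local Open Scope ring_scope.

(** * The uniform law and binary digits *)

Lemma measurable_preimage d d' (T : measurableType d) (U : measurableType d')
    (f : T -> U) (A : set U) :
  measurable_fun setT f -> measurable A -> measurable (f @^-1` A).
Proof. by move=> mf mA; rewrite -[X in measurable X]setTI; exact: mf. Qed.

Lemma probability_fine01 d (T : measurableType d) (R : realType)
    (P : probability T R) (A : set T) : measurable A -> 0 <= fine (P A) <= 1.
Proof.
move=> mA; rewrite fine_ge0//= -lee_fin fineK ?fin_num_measure//.
exact: probability_le1.
Qed.

Section uniform01.
Variable R : realType.
Local Notation U01 := (uniform_prob (@ltr01 R)).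

(** The distribution function of the uniform law on [0, 1]. *)
Definition clamp01 (x : R) : R :=
  if x <= 0 then 0 else if x <= 1 then x else 1.

Lemma clamp01_le0 x : x <= 0 -> clamp01 x = 0.
Proof. by rewrite /clamp01 => ->. Qed.

Lemma clamp01_ge1 x : 1 <= x -> clamp01 x = 1.
Proof. by rewrite /clamp01; do !case: ifPn; lra. Qed.

Lemma clamp01_id x : 0 <= x <= 1 -> clamp01 x = x.
Proof. by rewrite /clamp01; do !case: ifPn; lra. Qed.

Lemma clamp01_itv x : 0 <= clamp01 x <= 1.
Proof. by rewrite /clamp01; do !case: ifPn; lra. Qed.

(** Self-similarity of the uniform law: condition on the first binary digit. The distribution
    functions built from digits below satisfy the same recursion, which identifies them. *)
Lemma clamp01_halves x :
  clamp01 x = (clamp01 (2 * x) + clamp01 (2 * x - 1)) / 2.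
Proof.
have [x0|x0] := leP x 0; first by rewrite !clamp01_le0; lra.
have [xh|xh] := leP x 2^-1.
  by rewrite [clamp01 (_ - _)]clamp01_le0 ?clamp01_id; lra.
rewrite [clamp01 (2 * x)]clamp01_ge1; last by lra.
have [x1|x1] := leP x 1; first by rewrite !clamp01_id; lra.
by rewrite !clamp01_ge1; lra.
Qed.

Lemma uniform_prob01E (A : set R) : measurable A ->
  U01 A = lebesgue_measure (A `&` `[0, 1]).
Proof.
move=> mA; rewrite /uniform_prob integral_uniform_pdf.
rewrite (eq_integral (cst 1%E)).
  by rewrite integral_cst ?mul1e//; exact: measurableI.
move=> x; rewrite inE/= in_itv/= => -[_ x01].
by rewrite /uniform_pdf x01 subr0 invr1.
Qed.

Lemma uniform_prob01_lt x : U01 `]-oo, x[ = (clamp01 x)%:E.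
Proof.
rewrite uniform_prob01E//.
have [x0|x0] := leP x 0.
  rewrite (_ : _ `&` _ = set0) ?measure0 ?clamp01_le0//.
  by apply/seteqP; split => // z /=; rewrite !in_itv/=; lra.
have [x1|x1] := ltP 1 x.
  rewrite (_ : _ `&` _ = `[0, 1]%classic).
    by rewrite lebesgue_measure_itv/= lte_fin ltr01 sube0 clamp01_ge1// ltW.
  by apply/seteqP; split => z /=; rewrite !in_itv/=; lra.
rewrite (_ : _ `&` _ = `[0, x[%classic).
  by rewrite lebesgue_measure_itv/= lte_fin x0 sube0 clamp01_id// ltW.
by apply/seteqP; split => z /=; rewrite !in_itv/=; lra.
Qed.

(** Open left half-lines are closed under intersection, generate the Borel sets and exhaust the
    line, so they determine finite measures. The event [D] and the factor [c] let the criterion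
    treat joint laws as well. *)
Lemma law_eq_from_lt d (T : measurableType d) (P : probability T R)
    (u : T -> measurableTypeR R) (D : set T) (c : {nonneg R}) :
    measurable_fun setT u -> measurable D ->
    (forall x, P (u @^-1` `]-oo, x[ `&` D) = c%:num%:E * U01 `]-oo, x[)%E ->
  forall A, measurable A -> (P (u @^-1` A `&` D) = c%:num%:E * U01 A)%E.
Proof.
move=> mu mD lawlt A mA.
pose m1 : {measure set (measurableTypeR R) -> \bar R} :=
  pushforward (mrestr P mD) u.
pose m2 : {measure set (measurableTypeR R) -> \bar R} := mscale c U01.
have mA' : (@RGenInftyO.G R).-sigma.-measurable A
  by rewrite -RGenInftyO.measurableE.
have := @g_sigma_algebra_measure_unique _ R (measurableTypeR R)
  (@RGenInftyO.G R) _ (fun n => `]-oo, n%:R[%classic) _ _ (m1 mu) m2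
  _ _ _ A mA'.
apply => //.
- by move=> _ [x ->]; exact: measurable_itv.
- by move=> n; exists n%:R.
- apply/seteqP; split => // x _; exists (Num.truncn x).+1 => //=.
  by rewrite in_itv/= truncnS_gt.
- move=> _ _ [x ->] [y ->]; exists (Num.min x y).
  by apply/seteqP; split => z /=; rewrite !in_itv/= lt_min => /andP.
- by move=> _ [x ->]; exact: lawlt.
- move=> n; rewrite /m1/= /pushforward/= /mrestr/= lawlt uniform_prob01_lt.
  by rewrite -EFinM ltry.
Qed.

Definition bit (w : R) : bool := 2^-1 <= w.

(** On [0, 1], [bit] reads the first binary digit and this map shifts the expansion by one place. *)
Definition doubling (w : R) : R := 2 * w - (bit w)%:R.

Lemma measurable_bit : measurable_fun setT bit.
Proof. exact: measurable_fun_ler. Qed.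

Lemma measurable_doubling : measurable_fun setT doubling.
Proof.
apply: measurable_funB; first exact: measurable_funM.
rewrite (_ : (fun w => _) = fun w => if bit w then 1 else 0).
  by apply: measurable_fun_ifT => //; exact: measurable_bit.
by apply/funext => w; case: bit.
Qed.

Lemma measurable_bit_eq b : measurable [set w | bit w = b].
Proof.
by apply: (measurable_preimage measurable_bit (A := [set b])).
Qed.

(** The first digit is fair, and the shifted number is uniform and independent of it. On half-lines
    this is a computation of interval lengths. *)
Lemma doubling_law b (A : set R) : measurable A ->
  (U01 (doubling @^-1` A `&` [set w | bit w = b]) = 2^-1%:E * U01 A)%E.
Proof.
have half_ge0 : 0 <= 2^-1 :> R by [].
apply: (law_eq_from_lt (c := NngNum half_ge0)) => [||x].
- exact: measurable_doubling.
- exact: measurable_bit_eq.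
have mlt y : measurable [set` `]-oo, y[ : interval R] by exact: measurable_itv.
rewrite [RHS]/= uniform_prob01_lt -EFinM; case: b.
  have [x0|x0] := leP x 0.
    rewrite (_ : _ `&` _ = set0) ?measure0 ?clamp01_le0 ?mulr0//.
    apply/seteqP; split => // w [] /=; rewrite /doubling in_itv/= => + wb.
    by rewrite wb; move: wb; rewrite /bit /=; lra.
  (* In the upper half, 2w - 1 < x means that w lies in [1/2, (x + 1)/2[. *)
  transitivity (U01 (`]-oo, ((x + 1) / 2)[ `\` `]-oo, 2^-1[)).
    congr (U01 _); apply/seteqP; split => w /=; rewrite /doubling !in_itv/=.
      by move=> [+ wb]; rewrite wb; move: wb; rewrite /bit /=; lra.
    move=> [w1 w2]; have wb : bit w = true by rewrite /bit; lra.
    by rewrite wb /=; split => //; lra.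
  rewrite measureD //=; last by rewrite uniform_prob01_lt ltry.
  rewrite setIidr => [|z /=]; last by rewrite !in_itv/=; lra.
  rewrite !uniform_prob01_lt -EFinB; congr EFin.
  (* Halving at (x + 1)/2 produces [clamp01 (x + 1)], which is 1 since x > 0, and [clamp01 x]. *)
  rewrite (clamp01_halves ((x + 1) / 2)) (_ : 2 * _ - 1 = x); last by lra.
  rewrite [clamp01 (2 * _)]clamp01_ge1; last by lra.
  rewrite [clamp01 2^-1]clamp01_id; last by lra.
  by rewrite mulrDl mul1r addrC addKr mulrC.
have [x1|x1] := leP x 1.
  transitivity (U01 `]-oo, (x / 2)[).
    congr (U01 _); apply/seteqP; split => w /=; rewrite /doubling !in_itv/=.
      by move=> [+ wb]; rewrite wb /= subr0; lra.
    move=> w1; have wb : bit w = false by apply/negbTE; rewrite /bit; lra.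
    by rewrite wb /= subr0; split => //; lra.
  rewrite uniform_prob01_lt clamp01_halves (_ : 2 * (x / 2) = x); last by lra.
  by rewrite [clamp01 (x - 1)]clamp01_le0; [congr EFin; lra|lra].
transitivity (U01 `]-oo, 2^-1[).
  congr (U01 _); apply/seteqP; split => w /=; rewrite /doubling !in_itv/=.
    by move=> [_ /negbT]; rewrite /bit; lra.
  move=> w1; have wb : bit w = false by apply/negbTE; rewrite /bit; lra.
  by rewrite wb /= subr0; split => //; lra.
by rewrite uniform_prob01_lt clamp01_id ?clamp01_ge1 ?mulr1//; lra.
Qed.

Lemma doubling_law_setT (A : set R) : measurable A ->
  U01 (doubling @^-1` A) = U01 A.
Proof.
move=> mA; have mdA := measurable_preimage measurable_doubling mA.
rewrite -[X in U01 X]setIT.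
rewrite (_ : setT = [set w | bit w = true] `|` [set w | bit w = false]).
  rewrite setIUr measureU; last 3 first.
  - by apply: measurableI => //; exact: measurable_bit_eq.
  - by apply: measurableI => //; exact: measurable_bit_eq.
  - by apply/seteqP; split => // w [[_ /= ->] []].
  rewrite [X in (X + _)%E]doubling_law // [X in (_ + X)%E]doubling_law //.
  rewrite -ge0_muleDl ?lee_fin // -EFinD (_ : 2^-1 + 2^-1 = 1) ?mul1e//.
  by lra.
by apply/seteqP; split => // w _ /=; case: bit; [left|right].
Qed.

End uniform01.

(** Iterating the second hypothesis n times bounds every value by 2^-n. This replaces a uniqueness
    argument for contractions. *)
Lemma halving_eq0 (R : realType) (I : Type) (f : I -> R) :
    (forall i, `|f i| <= 1) -> (forall i, exists j, `|f i| <= `|f j| / 2) ->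
  forall i, f i = 0.
Proof.
move=> f1 fhalf i; apply/eqP; rewrite -normr_le0.
have bound n : forall i, `|f i| <= 2^-1 ^+ n.
  elim: n => [|n IH] {}i; first by rewrite expr0.
  have [j /le_trans] := fhalf i; apply.
  by rewrite exprSr ler_pM2r// invr_gt0.
have half_lt1 : `|2^-1 : R| < 1 by rewrite ger0_norm; lra.
have cvg0 := cvg_geometric 1 half_lt1.
rewrite -(cvg_lim _ cvg0)//; apply: limr_ge; first exact: cvgP cvg0.
by apply: nearW => n; rewrite /geometric/= mul1r; exact: bound.
Qed.

(** * Independence of the even and the odd binary digits *)

Section independent_pair.
Variable R : realType.
Local Notation U01 := (uniform_prob (@ltr01 R)).
Local Notation T := (@doubling R).

(** The first n digits at positions 0, 2, 4, ... of [w], reused as digits at positions 0, 1, 2,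
    ... *)
Fixpoint even_bits_trunc (n : nat) (w : R) : R :=
  if n is m.+1 then ((bit w)%:R + even_bits_trunc m (T (T w))) / 2 else 0.

Definition even_bits (w : R) : R := limn (even_bits_trunc ^~ w).

Definition odd_bits (w : R) : R := even_bits (T w).

Lemma even_bits_trunc01 n w : 0 <= even_bits_trunc n w <= 1.
Proof.
elim: n w => [|n IH] w /=; first by rewrite lexx ler01.
by have := IH (T (T w)); case: bit => /=; lra.
Qed.

Lemma even_bits_trunc_nd w : nondecreasing_seq (even_bits_trunc ^~ w).
Proof.
apply/nondecreasing_seqP => n; elim: n w => [|n IH] w.
  by have /andP[] := even_bits_trunc01 1 w.
rewrite /= ler_pM2r ?invr_gt0// lerD2l; exact: IH.
Qed.

Lemma even_bits_cvg w : even_bits_trunc n w @[n --> \oo] --> even_bits w.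
Proof.
apply: nondecreasing_is_cvgn; first exact: even_bits_trunc_nd.
by exists 1 => _ [n _ <-]; have /andP[] := even_bits_trunc01 n w.
Qed.

Lemma even_bits01 w : 0 <= even_bits w <= 1.
Proof.
apply/andP; split; [apply: limr_ge|apply: limr_le];
  try exact: even_bits_cvg;
  by apply: nearW => n; have /andP[] := even_bits_trunc01 n w.
Qed.

(** Once the first digit is removed, the remaining even positions become the odd ones of [T w]. *)
Lemma even_bitsE w : even_bits w = ((bit w)%:R + odd_bits (T w)) / 2.
Proof.
apply: cvg_lim => //; rewrite -cvg_shiftS /=.
by apply: cvgMl; apply: cvgD; [exact: cvg_cst|exact: even_bits_cvg].
Qed.

Lemma measurable_even_bits : measurable_fun setT even_bits.
Proof.
apply: (@measurable_fun_cvg _ _ _ _ even_bits_trunc); last first.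
  by move=> w _; exact: even_bits_cvg.
elim=> [|n IH] /=; first exact: measurable_cst.
apply: measurable_funM => //; apply: measurable_funD; last first.
  apply: measurableT_comp => //; apply: measurableT_comp;
  exact: measurable_doubling.
rewrite (_ : (fun w => _) = fun w : R => if bit w then 1 else 0).
  by apply: measurable_fun_ifT => //; exact: measurable_bit.
by apply/funext => w; case: bit.
Qed.

Lemma measurable_odd_bits : measurable_fun setT odd_bits.
Proof.
by apply: measurableT_comp; [exact: measurable_even_bits|
  exact: measurable_doubling].
Qed.

Definition even_odd_lt (x y : R) : set R :=
  even_bits @^-1` `]-oo, x[ `&` odd_bits @^-1` `]-oo, y[.

Lemma measurable_even_lt x : measurable (even_bits @^-1` `]-oo, x[).
Proof. exact: (measurable_preimage measurable_even_bits). Qed.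

Lemma measurable_odd_lt x : measurable (odd_bits @^-1` `]-oo, x[).
Proof. exact: (measurable_preimage measurable_odd_bits). Qed.

Lemma measurable_even_odd_lt x y : measurable (even_odd_lt x y).
Proof.
by apply: measurableI; [exact: measurable_even_lt|exact: measurable_odd_lt].
Qed.

(* Splitting on the first digit swaps the roles of even and odd digits. *)
Lemma even_odd_lt_halves x y :
  U01 (even_odd_lt x y) = (2^-1%:E * (U01 (even_odd_lt y (2 * x)) +
     U01 (even_odd_lt y (2 * x - 1))))%E.
Proof.
have -> : even_odd_lt x y =
    (T @^-1` even_odd_lt y (2 * x) `&` [set w | bit w = false]) `|`
    (T @^-1` even_odd_lt y (2 * x - 1) `&` [set w | bit w = true]).
  apply/seteqP; split => w; rewrite /even_odd_lt /= !in_itv/= (even_bitsE w).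
    by case: (bit w) => /= -[? ?]; [right|left]; split => //; split=> //; lra.
  by case=> -[[wy wx] ->] /=; split => //; lra.
have mT : measurable_fun setT T by exact: measurable_doubling.
rewrite measureU; last 3 first.
- apply: measurableI; last exact: measurable_bit_eq.
  by apply: measurable_preimage => //; exact: measurable_even_odd_lt.
- apply: measurableI; last exact: measurable_bit_eq.
  by apply: measurable_preimage => //; exact: measurable_even_odd_lt.
- by apply/seteqP; split => // w [[_ /= ->] []].
have law b z := doubling_law b (measurable_even_odd_lt y z).
by rewrite ge0_muleDr//; congr (_ + _)%E; exact: law.
Qed.

Let even_odd_cdf x y : R := fine (U01 (even_odd_lt x y)).

Lemma even_odd_cdf_halves x y : even_odd_cdf x y =
  (even_odd_cdf y (2 * x) + even_odd_cdf y (2 * x - 1)) / 2.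
Proof.
rewrite /even_odd_cdf even_odd_lt_halves.
have fin u v : U01 (even_odd_lt u v) \is a fin_num.
  by apply: fin_num_measure; exact: measurable_even_odd_lt.
rewrite -(fineK (fin y (2 * x))) -(fineK (fin y (2 * x - 1))).
by rewrite -EFinD -EFinM /= mulrC.
Qed.

(** The bound on [y] is strict because digits all equal to 1 give the value 1, which an open
    half-line ending at 1 misses. *)
Lemma even_odd_lt_gt1r x y : 1 < y ->
  even_odd_lt x y = even_bits @^-1` `]-oo, x[.
Proof.
move=> y1; apply/seteqP; split => w; rewrite /even_odd_lt /= !in_itv/=.
  by case.
by have := even_bits01 (T w); rewrite -/(odd_bits w); lra.
Qed.

Lemma even_odd_lt_gt1l x y : 1 < x ->
  even_odd_lt x y = odd_bits @^-1` `]-oo, y[.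
Proof.
move=> x1; apply/seteqP; split => w; rewrite /even_odd_lt /= !in_itv/=.
  by case.
by have := even_bits01 w; lra.
Qed.

Lemma even_odd_lt_le0r x y : y <= 0 -> even_odd_lt x y = set0.
Proof.
move=> y0; apply/seteqP; split => w; rewrite /even_odd_lt /= !in_itv//=.
by have := even_bits01 (T w); rewrite -/(odd_bits w); lra.
Qed.

Lemma odd_bits_law (A : set R) : measurable A ->
  U01 (odd_bits @^-1` A) = U01 (even_bits @^-1` A).
Proof.
move=> mA; rewrite -(doubling_law_setT (A := even_bits @^-1` A))//.
by apply: measurable_preimage => //; exact: measurable_even_bits.
Qed.

(* The halving recursion contracts: of the arguments 2z and 2z - 1, one always
   lies where the cdf is known. *)
Lemma even_bits_cdf x : even_odd_cdf x 2 = clamp01 x.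
Proof.
(* Since 2 exceeds every value of [odd_bits], [F] is the distribution function of [even_bits]
   alone. *)
pose F z := even_odd_cdf z 2; pose D z := F z - clamp01 z.
have two1 : 1 < 2 :> R by lra.
have Fodd z : even_odd_cdf 2 z = F z.
  rewrite /F /even_odd_cdf (even_odd_lt_gt1l _ two1) (even_odd_lt_gt1r _ two1).
  by congr fine; exact: odd_bits_law.
have Fhalf z : F z = (F (2 * z) + F (2 * z - 1)) / 2.
  by rewrite -!Fodd -even_odd_cdf_halves.
have Dle0 z : z <= 0 -> D z = 0.
  move=> z0; rewrite /D clamp01_le0// -Fodd /even_odd_cdf even_odd_lt_le0r//.
  by rewrite measure0 subrr.
have Dgt1 z : 1 < z -> D z = 0.
  move=> z1; rewrite /D clamp01_ge1 ?ltW// /F /even_odd_cdf.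
  rewrite (even_odd_lt_gt1r _ two1) (_ : _ @^-1` _ = setT).
    by rewrite probability_setT subrr.
  apply/seteqP; split => // w _ /=; rewrite in_itv/=.
  by have := even_bits01 w; lra.
have Dhalf z : D z = (D (2 * z) + D (2 * z - 1)) / 2.
  by rewrite /D Fhalf (clamp01_halves z); lra.
apply/eqP; rewrite -subr_eq0; apply/eqP.
apply: (@halving_eq0 _ _ D) => z.
  have := probability_fine01 U01 (measurable_even_odd_lt z 2).
  have := clamp01_itv z.
  by rewrite ler_norml /D /F /even_odd_cdf; lra.
have half_ge0 : 0 <= 2^-1 :> R by [].
have [zh|zh] := leP z 2^-1.
  exists (2 * z); rewrite Dhalf [D (_ - 1)]Dle0 ?addr0; last by lra.
  by rewrite normrM (ger0_norm half_ge0).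
exists (2 * z - 1); rewrite Dhalf [D (2 * z)]Dgt1 ?add0r; last by lra.
by rewrite normrM (ger0_norm half_ge0).
Qed.

(** The contraction argument again, now on pairs. The recursion puts the doubled argument second, so
    the boundary values are needed only for second arguments at most 0, where both sides vanish, or
    above 1, where the one-variable result applies. *)
Lemma even_odd_cdfE x y : even_odd_cdf x y = clamp01 x * clamp01 y.
Proof.
pose D (z : R * R) := even_odd_cdf z.1 z.2 - clamp01 z.1 * clamp01 z.2.
have Dle0 u v : v <= 0 -> D (u, v) = 0.
  move=> v0; rewrite /D /= (clamp01_le0 v0) /even_odd_cdf even_odd_lt_le0r//.
  by rewrite measure0 mulr0 subrr.
have Dgt1 u v : 1 < v -> D (u, v) = 0.
  move=> v1; rewrite /D /= (clamp01_ge1 (ltW v1)) mulr1 -even_bits_cdf.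
  have two1 : 1 < 2 :> R by lra.
  rewrite /even_odd_cdf (even_odd_lt_gt1r _ v1) (even_odd_lt_gt1r _ two1).
  by rewrite subrr.
have Dhalf u v : D (u, v) = (D (v, 2 * u) + D (v, 2 * u - 1)) / 2.
  by rewrite /D /= even_odd_cdf_halves (clamp01_halves u); lra.
apply/eqP; rewrite -subr_eq0; apply/eqP.
apply: (@halving_eq0 _ _ D _ _ (x, y)) => -[u v].
  have := probability_fine01 U01 (measurable_even_odd_lt u v).
  have := clamp01_itv u; have := clamp01_itv v.
  by rewrite ler_norml /D /= /even_odd_cdf; nra.
have half_ge0 : 0 <= 2^-1 :> R by [].
have [uh|uh] := leP u 2^-1.
  exists (v, 2 * u); rewrite Dhalf [D (_, _ - 1)]Dle0 ?addr0; last by lra.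
  by rewrite normrM (ger0_norm half_ge0).
exists (v, 2 * u - 1); rewrite Dhalf [D (_, 2 * u)]Dgt1 ?add0r; last by lra.
by rewrite normrM (ger0_norm half_ge0).
Qed.

Lemma even_bits_law (A : set R) : measurable A ->
  U01 (even_bits @^-1` A) = U01 A.
Proof.
move=> mA; rewrite -[LHS](congr1 U01 (setIT _)).
rewrite (law_eq_from_lt (c := 1%:nng) _ _ _ mA) ?mul1e//.
- exact: measurable_even_bits.
- move=> x; rewrite setIT mul1e -(@even_odd_lt_gt1r x 2) ?uniform_prob01_lt.
    rewrite -even_bits_cdf /even_odd_cdf fineK// fin_num_measure//.
    exact: measurable_even_odd_lt.
  by lra.
Qed.

(** The product formula is extended from half-lines one coordinate at a time: first to all [A] with
    the odd half-line event fixed, then to all [B] with the even event fixed. *)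
Lemma even_odd_indep (A B : set R) : measurable A -> measurable B ->
  (U01 (even_bits @^-1` A `&` odd_bits @^-1` B) = U01 A * U01 B)%E.
Proof.
have law_lt y C : measurable C -> (U01 (even_bits @^-1` C `&`
    odd_bits @^-1` `]-oo, y[) = (clamp01 y)%:E * U01 C)%E.
  have /andP[y0 _] := clamp01_itv y.
  apply: (law_eq_from_lt (c := NngNum y0)) => [||x] /=.
  - exact: measurable_even_bits.
  - exact: measurable_odd_lt.
  rewrite uniform_prob01_lt -EFinM mulrC -even_odd_cdfE fineK//.
  by rewrite fin_num_measure//; exact: measurable_even_odd_lt.
move=> mA mB; have mevenA := measurable_preimage measurable_even_bits mA.
have finA : U01 A \is a fin_num by rewrite fin_num_measure.
have A0 : 0 <= fine (U01 A) by rewrite fine_ge0.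
rewrite -(fineK finA) setIC.
apply: (law_eq_from_lt (c := NngNum A0)) => [|//|y|//] /=.
  exact: measurable_odd_bits.
by rewrite setIC law_lt// uniform_prob01_lt fineK// muleC.
Qed.

End independent_pair.

(** * An i.i.d. uniform sequence from one uniform variable *)

Section iid_uniform.
Variable R : realType.
Local Notation U01 := (uniform_prob (@ltr01 R)).

Definition iid_uniform (n : nat) (w : R) : R :=
  even_bits (iter n (@odd_bits R) w).

Lemma measurable_iid_uniform n : measurable_fun setT (iid_uniform n).
Proof.
apply: measurableT_comp; first exact: measurable_even_bits.
elim: n => [|n IH] /=; first exact: measurable_id.
by apply: measurableT_comp => //; exact: measurable_odd_bits.
Qed.

Lemma iid_uniform_preimageS n (A : set R) :
  iid_uniform n.+1 @^-1` A = @odd_bits R @^-1` (iid_uniform n @^-1` A).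
Proof. by apply/seteqP; split => w /=; rewrite /iid_uniform iterSr. Qed.

Lemma iid_uniform_law n (A : set R) : measurable A ->
  U01 (iid_uniform n @^-1` A) = U01 A.
Proof.
move=> mA; elim: n => [|n IH]; first exact: even_bits_law.
have mZ := measurable_preimage (measurable_iid_uniform n) mA.
by rewrite iid_uniform_preimageS (odd_bits_law mZ) (even_bits_law mZ).
Qed.

(** The variable of index 0 depends on the even digits and all later ones on the odd digits, so
    independence of the two splits off one factor and leaves the shifted sequence. *)
Lemma iid_uniform_prod N (B : nat -> set R) : (forall n, measurable (B n)) ->
  U01 (\bigcap_(n in `I_N) iid_uniform n @^-1` B n) =
  (\prod_(0 <= n < N) U01 (B n))%E.
Proof.
elim: N B => [|N IH] B mB.
  rewrite big_geq// (_ : \bigcap_(_ in _) _ = setT) ?probability_setT//.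
  by apply/seteqP; split.
rewrite big_nat_recl// -IH// -even_odd_indep//; last first.
  by apply: bigcap_measurableType => n _; exact: measurable_preimage
    (measurable_iid_uniform n) (mB n.+1).
congr (U01 _); rewrite preimage_bigcap; apply/seteqP; split => w /= Zw.
  split; first exact: (Zw 0%N).
  by move=> n nN; have := Zw n.+1 nN; rewrite iid_uniform_preimageS.
case: Zw => Z0 ZS [|n] nN //.
by rewrite iid_uniform_preimageS; exact: ZS.
Qed.

(** Each source depends on a single variable, and injectivity of [pickle] makes distinct sources use
    distinct variables. *)
Lemma mutually_independent_iid_uniform (I : countType)
    (F : I -> set_system R) :
  (forall i, F i `<=`
    preimage_set_system setT (iid_uniform (pickle i)) measurable) ->
  mutually_independent U01 F.
Proof.
move=> FZ J A uJ FA.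
have /choice[B AB] i : exists B : set R, measurable B /\
    (i \in J -> A i = iid_uniform (pickle i) @^-1` B).
  case: (boolP (i \in J)) => [iJ|_]; last by exists setT.
  by have [B mB <-] := FZ _ _ (FA _ iJ); exists B; rewrite setTI.
(* Indices below [N] that code no element of [J] receive the sure event, so that the product formula
   over an initial segment applies; their factors are 1. *)
pose C n := if [pick i : seq_sub J | pickle (val i) == n] is Some i
  then B (val i) else setT.
have C_pickle i : i \in J -> C (pickle i) = B i.
  move=> iJ; rewrite /C; case: pickP => [j /eqP /(pcan_inj pickleK) -> //|].
  by move=> /(_ (SeqSub iJ)); rewrite eqxx.
have C_out n : n \notin map pickle J -> C n = setT.
  rewrite /C; case: pickP => // -[i iJ] /= /eqP <- /negP[].
  exact: map_f.
have mC n : measurable (C n).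
  by rewrite /C; case: pickP => // i _; have [] := AB (val i).
pose N := (\max_(i <- J) pickle i).+1.
have ltN i : i \in J -> (pickle i < N)%N.
  by move=> iJ; rewrite ltnS; exact: leq_bigmax_seq.
transitivity (U01 (\bigcap_(n in `I_N) iid_uniform n @^-1` C n)).
  congr (U01 _); apply/seteqP; split => w /= Zw.
    move=> n nN; have [/mapP[i iJ ->]|nJ] := boolP (n \in map pickle J).
      have [_ /(_ iJ) Ai] := AB i.
      by have := Zw i iJ; rewrite C_pickle// Ai.
    by rewrite C_out.
  move=> i iJ; have [_ ->//] := AB i.
  by have := Zw (pickle i) (ltN i iJ); rewrite C_pickle.
rewrite iid_uniform_prod// (bigID (mem (map pickle J)))/=.
rewrite [X in (_ * X)%E]big1 ?mule1 => [|n /C_out ->]; last first.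
  exact: probability_setT.
rewrite -big_filter (perm_big (map pickle J)); last first.
  apply: uniq_perm; first by rewrite filter_uniq// iota_uniq.
    by rewrite map_inj_uniq//; exact: pcan_inj pickleK.
  move=> n; rewrite mem_filter mem_index_iota /= andb_idr// => /mapP[i iJ ->].
  exact: ltN.
rewrite big_map big_seq [RHS]big_seq; apply: eq_bigr => i iJ.
have [mB ->//] := AB i.
by rewrite C_pickle// iid_uniform_law.
Qed.

End iid_uniform.

(** * Uniform variables that are surely positive *)

Section positive_uniform.
Variable R : realType.
Local Notation U01 := (uniform_prob (@ltr01 R)).

(* Moving the null set where the variable vanishes makes 0 < U <= 1 hold
   surely, so that payoffs can be compared pointwise. *)
Definition nonpos_to1 (x : R) : R := if 0 < x then x else 1.

Lemma measurable_nonpos_to1 : measurable_fun setT nonpos_to1.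
Proof.
by apply: measurable_fun_ifT => //; exact: measurable_fun_ltr.
Qed.

Lemma nonpos_to1_law (A : set R) : measurable A ->
  U01 (nonpos_to1 @^-1` A) = U01 A.
Proof.
(* The uniform law charges only ]0, +oo[, where [nonpos_to1] is the identity. *)
have posE (B : set R) : measurable B -> U01 B = U01 (B `&` `]0, +oo[).
  move=> mB; have := measureDI U01 mB (measurable_itv `]-oo, 0]).
  move=> ->; rewrite addeC.
  rewrite [X in (X + _)%E](_ : _ = 0%E) ?add0e.
    by rewrite setDE setCitvl.
  have mB0 : measurable (B `&` `]-oo, 0]) by exact: measurableI.
  apply: (etrans (uniform_prob01E mB0)).
  apply: (@subset_measure0 _ (measurableTypeR R) R lebesgue_measure _
    [set 0%R]); last exact: lebesgue_measure_set1.
  - exact: measurableI.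
  - exact: measurable_set1.
  by move=> w [[_ /=]]; rewrite !in_itv/= => *; apply/le_anti; lra.
move=> mA; have mA' := measurable_preimage measurable_nonpos_to1 mA.
rewrite (posE _ mA) (posE _ mA'); congr (U01 _).
by apply/seteqP; split => w /= []; rewrite in_itv/= andbT /nonpos_to1;
  move=> + w0; rewrite w0.
Qed.

Definition noise (n : nat) (w : R) : R := nonpos_to1 (iid_uniform n w).

Lemma measurable_noise n : measurable_fun setT (noise n).
Proof.
apply: measurableT_comp; first exact: measurable_nonpos_to1.
exact: measurable_iid_uniform.
Qed.

Lemma noise01 n w : 0 < noise n w <= 1.
Proof.
rewrite /noise /nonpos_to1; case: ifPn => [->|_]; last by rewrite ltr01 lexx.
by have /andP[] := even_bits01 (iter n (@odd_bits R) w).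
Qed.

Lemma noise_law n (A : set R) : measurable A ->
  U01 (noise n @^-1` A) = U01 A.
Proof.
move=> mA; have mA' := measurable_preimage measurable_nonpos_to1 mA.
by rewrite -(nonpos_to1_law mA) -(iid_uniform_law n mA').
Qed.

Lemma noise_preimage_sub n : preimage_set_system setT (noise n) measurable `<=`
  preimage_set_system setT (@iid_uniform R n) measurable.
Proof.
move=> _ [B mB <-]; exists (nonpos_to1 @^-1` B) => //.
exact: measurable_preimage measurable_nonpos_to1 mB.
Qed.

End positive_uniform.

(** * The game on a one-point space *)

Lemma first_timeP (a : pred nat) t :
  first_time a = Some t <-> a t /\ forall u, (u < t)%N -> ~~ a u.
Proof.
rewrite /first_time; case: pselect => [ex_a|nex_a]; last first.
  by split=> // -[at_ _]; case: nex_a; exists t.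
case: ex_minnP => m am m_min; split => [[<-]|[at_ t_min]].
  by split => // u; apply: contraTN => /m_min; rewrite -leqNgt.
congr Some; apply/eqP; rewrite eqn_leq m_min//= leqNgt.
by apply: contraL am; exact: t_min.
Qed.

Lemma first_time_None (a : pred nat) :
  first_time a = None <-> forall u, ~~ a u.
Proof.
rewrite /first_time; case: pselect => [ex_a|nex_a]; split => //.
  by move=> na; have [u au] := ex_a; have := na u; rewrite au.
by move=> _ u; apply/negP => au; apply: nex_a; exists u.
Qed.

Lemma first_time0 (a : pred nat) : a 0%N -> first_time a = Some 0%N.
Proof. by move=> a0; apply/first_timeP. Qed.

Lemma first_time_reached (tau : option nat) : first_time (reached tau) = tau.
Proof.
case: tau => [t|]; last exact/first_time_None.
by apply/first_timeP; split => [|u] /=; rewrite ?leqnn// -ltnNge.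
Qed.

(** The time takes countably many values, and each of its level sets is a countable intersection of
    measurable events. *)
Lemma measurable_first_time d (T : measurableType d) (R : realType)
    (a : nat -> T -> bool) (c : option nat -> R) :
    (forall t, measurable_fun setT (a t)) ->
  measurable_fun setT (fun w => c (first_time (a ^~ w))).
Proof.
move=> ma _ B mB; rewrite setTI.
have m1 t : measurable [set w | a t w].
  by apply: (measurable_preimage (ma t) (A := [set true])).
have m0 t : measurable [set w | ~~ a t w].
  have -> : [set w | ~~ a t w] = ~` [set w | a t w].
    by apply/seteqP; split => w /= /negP.
  exact: measurableC.
pose S o := [set w | first_time (a ^~ w) = o].
have mS o : measurable (S o).
  case: o => [t|].
    rewrite (_ : S _ = [set w | a t w] `&`
        \bigcap_(u in `I_t) [set w | ~~ a u w]).
      by apply: measurableI => //; exact: bigcap_measurableType.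
    apply/seteqP; split => w; first by move=> /first_timeP.
    by move=> aw; apply/first_timeP.
  rewrite (_ : S _ = \bigcap_u [set w | ~~ a u w]).
    exact: bigcap_measurableType.
  apply/seteqP; split => w; first by move=> /first_time_None aw u _; exact: aw.
  by move=> aw; apply/first_time_None => u; exact: aw.
rewrite (_ : _ @^-1` B = \bigcup_o (S o `&` [set w | B (c o)])).
  apply: countable_bigcupT_measurable => [|o]; first exact: countableP.
  apply: measurableI => //; have [Bo|nBo] := pselect (B (c o)).
    by rewrite (_ : [set _ | _] = setT)//; apply/seteqP; split.
  by rewrite (_ : [set _ | _] = set0)//; apply/seteqP; split.
apply/seteqP; split => w /=; first by move=> ?; exists (first_time (a ^~ w)).
by move=> [tau _ [<-]].
Qed.

(** * No policy is an equilibrium when the state space is a point *)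

Section counterexample.
Variables (R : realType) (X : ptopologicalType).
Hypothesis X1 : forall x y : X, x = y.
Variables (Pi : R.-pker (borel X) ~> (borel X)).
Variables (d : measure_display) (Omega : measurableType d).
Variables (P : X -> probability Omega R) (Xt : nat -> Omega -> X).
Variables (Y Y' : nat -> Omega -> R).
Hypothesis mY : forall t, measurable_fun setT (Y t).
Hypothesis Y01 : forall t w, 0 < Y t w <= 1.
Hypothesis Y'01 : forall t w, 0 < Y' t w <= 1.
Hypothesis PY0 : forall x q, 0 < q <= 1 -> (0 < P x (Y 0%N @^-1` `]-oo, q[))%E.

Definition leader0 : player R X :=
  Player (cst (- 1)) (cst (- 2)) (cst (- 1)) 2^-1.

Definition follower0 : player R X := Player (cst 0) (cst 1) (cst 1) 2^-1.

Lemma subsingleton_measurable_fun d' (U : measurableType d') (f : X -> U) :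
  measurable_fun setT (f : borel X -> U).
Proof.
rewrite (_ : f = cst (f point)); first exact: measurable_cst.
by apply/funext => y; rewrite (X1 y point).
Qed.

Lemma subsingleton_bounded_borel (f : X -> R) : bounded_borel f.
Proof.
split; last exact: subsingleton_measurable_fun.
exists `|f point|; split => [|M fM y _ /=]; first exact: num_real.
by rewrite (X1 y point); exact: ltW.
Qed.

Lemma subsingleton_Rintegral x (f : X -> R) : \int[Pi x]_y f y = f x.
Proof.
rewrite (_ : f = cst (f x)); last by apply/funext => y; rewrite (X1 y x).
by rewrite /= Rintegral_cst// prob_kernel mulr1.
Qed.

Lemma r_star0 : r_star follower0 = cst 1.
Proof. by apply/funext => y; rewrite /r_star lexx. Qed.

Lemma W_C0_solves p : markov_policy p ->
  solves_W_C Pi follower0 p (W_C Pi follower0 p).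
Proof.
move=> [_ p01]; apply: (@xgetPex _ _ [set W | solves_W_C Pi follower0 p W]).
(* On one point the equation reads W = max(0, (p + (1 - p) W)/2); equality with the second term
   gives W (1 + p) = p. *)
exists (fun x => p x / (1 + p x)).
split=> [|x]; first exact: subsingleton_bounded_borel.
rewrite subsingleton_Rintegral /W_S /= maxxx mulr1.
have := p01 x; set q := p x => q01.
have -> : 2^-1 * (q + (1 - q) * (q / (1 + q))) = q / (1 + q) by field; lra.
by rewrite max_r// divr_ge0; lra.
Qed.

(** The value of waiting is positive exactly when [p x] is. At [p x = 0] it ties with the payoff 0
    of stopping, and the earliest response stops; this jump drives the counterexample. *)
Lemma q_star0 p x : markov_policy p ->
  q_star Pi follower0 p x = if 0 < p x then 0 else 1.
Proof.
move=> mp; have [_ /(_ x)] := W_C0_solves mp; case: mp => _ /(_ x) px01.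
rewrite subsingleton_Rintegral /W_S /= maxxx mulr1 /q_star /=.
(* A negative continuation term would force W = 0, but then that term would be p/2. *)
set W := W_C _ _ _ _; rewrite maxEle; case: ifPn => [c0|+] WE; last first.
  by rewrite WE; lra.
have [px0|px0] := ltP 0 (p x).
  case: ifPn => // W0; have WE0 : W = 0 by lra.
  by rewrite WE0 in WE; lra.
have p0 : p x = 0 by lra.
by rewrite p0 in WE; case: ifPn => //; lra.
Qed.

Lemma subsingleton_policy (q : R) : 0 <= q <= 1 ->
  markov_policy (cst q : X -> R).
Proof. by move=> q01; split => //; exact: subsingleton_measurable_fun. Qed.

Lemma zero_not_equilibrium x p : markov_policy p -> p x = 0 ->
  ~ randomized_exact_equilibrium Pi P Xt Y Y' leader0 follower0 p.
Proof.
move=> mp px0 [_ /(_ x (cst 1))].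
have p1 : markov_policy (cst 1 : X -> R) by apply: subsingleton_policy; lra.
move=> /(_ p1); apply/negP; rewrite -ltNge /V /V_concat1 /J1.
have q1 : q_star Pi follower0 p = cst 1.
  by apply/funext => y; rewrite q_star0// (X1 y x) px0 ltxx.
have f0 s w : follower_time Xt Y Y' s (r_star follower0)
    (q_star Pi follower0 p) w = Some 0%N.
  rewrite r_star0 q1; apply: first_time0; rewrite if_same.
  by have /andP[] := Y'01 0%N w.
have l0 w : leader_time Xt Y (concat1 (cst 1) p) w = Some 0%N.
  by apply: first_time0; have /andP[] := Y01 0%N w.
under eq_Rintegral do rewrite f0.
under [ltRHS]eq_Rintegral do rewrite f0 l0 /= minnn expr0 mul1r.
have -> : (fun w => leader_payoff Xt leader0
    (leader_time Xt Y (fun=> p) w) (Some 0%N) w) = cst (- 2).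
  apply/funext => w; case E : leader_time => [[|t]|] /=.
  (* Stopping at time 0 would need [Y 0 w <= 0], which sure positivity excludes; hence the follower
     is always strictly first. *)
  - move: E => /first_timeP[]; rewrite (X1 (Xt 0%N w) x) px0.
    by have /andP[] := Y01 0%N w; lra.
  - by rewrite minn0 expr0 mul1r.
  - by rewrite expr0 mul1r.
rewrite !Rintegral_cst// [fine _](congr1 fine (probability_setT (P x))) /=.
by lra.
Qed.

Definition stopping_payoff (tau : option nat) : R :=
  if tau is Some t then - 2^-1 ^+ t else 0.

(* The follower stops exactly when the leader does, so only ties pay. *)
Lemma J1_waiting_follower x s p : markov_policy p -> 0 < p x ->
  J1 P Xt Y Y' leader0 x s (r_star follower0) (q_star Pi follower0 p) =
  \int[P x]_w stopping_payoff (leader_time Xt Y s w).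
Proof.
move=> mp px0; apply: eq_Rintegral => w _.
have q0 : q_star Pi follower0 p = cst 0.
  by apply/funext => y; rewrite q_star0// (X1 y x) px0.
rewrite /follower_time r_star0 q0.
(* As Y' lies in ]0, 1], threshold 1 always triggers a stop and threshold 0 never does. *)
rewrite (_ : (fun t => _) = reached (leader_time Xt Y s w)).
  rewrite first_time_reached; case: leader_time => //= t.
  by rewrite minnn ltnn mulrN1.
apply/funext => t; have /andP[] := Y'01 t w.
by case: reached => /=; lra.
Qed.

Lemma integrable_stopping_payoff x s : (forall t y, 0 <= s t y <= 1) ->
  (P x).-integrable setT
    (EFin \o (fun w => stopping_payoff (leader_time Xt Y s w))).
Proof.
move=> s01; apply: measurable_bounded_integrable => //.
- by apply: le_lt_trans (ltry 1); rewrite probability_le1.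
- apply: measurable_first_time => t.
  rewrite (_ : (fun w => _) = fun w => Y t w <= s t x).
    exact: measurable_fun_ler.
  by apply/funext => w; rewrite (X1 (Xt t w) x).
- exists 1; split => [|M M1 w _ /=]; first exact: num_real.
  apply: le_trans (ltW M1); case: leader_time => [t|] /=; last by rewrite normr0.
  by rewrite normrN normrX exprn_ile1// ger0_norm; lra.
Qed.

(** The policy and its one-period postponement are compared pointwise on the same noise.
    Postponement never loses, and it gains at least 1/2 on an event of positive probability. *)
Lemma positive_not_equilibrium x p : markov_policy p -> 0 < p x ->
  ~ randomized_exact_equilibrium Pi P Xt Y Y' leader0 follower0 p.
Proof.
move=> mp px0 [_ /(_ x (cst 0))].
have m0 : markov_policy (cst 0 : X -> R) by apply: subsingleton_policy; lra.
move=> /(_ m0); apply/negP; rewrite -ltNge /V /V_concat1 !J1_waiting_follower//.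
pose A := Y 0%N @^-1` `]-oo, (p x)[.
have mA : measurable A by exact: measurable_preimage.
have p01 : 0 <= p x <= 1 by case: mp.
have PA0 : (0 < P x A)%E by apply: PY0; rewrite px0; case/andP: p01.
have i1 := @integrable_stopping_payoff x (fun=> p) (fun _ => mp.2).
have i2 : (P x).-integrable setT (EFin \o (fun w =>
    stopping_payoff (leader_time Xt Y (concat1 (cst 0) p) w))).
  apply: integrable_stopping_payoff => -[|t] y; last exact: mp.2.
  by rewrite lexx ler01.
rewrite -subr_gt0 -RintegralB//.
have PA_gt0 : 0 < \int[P x]_w (2^-1 * \1_A w).
  rewrite RintegralZl//; last exact: integrable_indic.
  rewrite /Rintegral integral_indic// setIT mulr_gt0//.
  by rewrite fine_gt0// PA0 (le_lt_trans (probability_le1 _ mA)) ?ltry.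
apply: lt_le_trans PA_gt0 _; apply: le_Rintegral => //.
- rewrite (_ : _ \o _ = fun w => (2^-1%:E * (EFin \o \1_A) w)%E).
    by apply: integrableZl => //; exact: integrable_indic.
  by apply/funext => w /=; rewrite EFinM.
- exact: (integrableB measurableT i2 i1).
move=> w _; rewrite indicE; have /andP[Y0_gt0 _] := Y01 0%N w.
(* With policy 0 at time 0 and Y > 0, the leader stops at time 1 at the earliest, if ever. *)
have late : - 2^-1 <= stopping_payoff (leader_time Xt Y (concat1 (cst 0) p) w).
  case E : leader_time => [[|t]|] /=; last by lra.
    by move: E => /first_timeP[] /=; lra.
  by rewrite lerN2 exprS ger_pMr// exprn_ile1//; lra.
have [Y0p|pY0] := leP (Y 0%N w) (p x).
  have -> : leader_time Xt Y (fun=> p) w = Some 0%N.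
    by apply: first_time0; rewrite (X1 (Xt 0%N w) x).
  by rewrite /= expr0; case: (w \in A) => /=; lra.
rewrite memNset => [|]; last by rewrite /A /= in_itv/=; lra.
(* When Y at time 0 exceeds [p x], neither strategy stops then, and they agree afterwards. *)
suff -> : leader_time Xt Y (concat1 (cst 0) p) w = leader_time Xt Y (fun=> p) w.
  by rewrite subrr mulr0.
congr first_time; apply/funext => -[|t] //=.
by rewrite (X1 (Xt 0%N w) x) leNgt Y0_gt0 leNgt pY0.
Qed.

Lemma no_equilibrium p :
  ~ randomized_exact_equilibrium Pi P Xt Y Y' leader0 follower0 p.
Proof.
move=> eqp; have [mp _] := eqp; have [_ /(_ point) /andP[p0 _]] := mp.
move: p0 eqp; rewrite le_eqVlt => /predU1P[/esym p0|p0].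
  exact: zero_not_equilibrium p0.
exact: positive_not_equilibrium p0.
Qed.

End counterexample.

(** * The constant chain and its randomization devices *)

Section one_point_chain.
Variables (R : realType) (X : ptopologicalType).
Hypothesis X1 : forall x y : X, x = y.
Local Notation U01 := (uniform_prob (@ltr01 R)).

Definition one_point_kernel : R.-pker (borel X) ~> (borel X) :=
  kdirac (@measurable_id _ (borel X) setT).

Lemma one_point_has_densities : has_densities one_point_kernel.
Proof.
(* The Dirac mass at the only point serves as the reference law. *)
exists \d_(point : borel X), (cst 1); split=> [|//|x A mA].
  exact: measurable_cst.
rewrite (eq_integral (cst 1%E))// integral_cst// mul1e (X1 x point).
exact: erefl.
Qed.

(** Maps into a point are constant, so their preimages are trivial events, which already form a
    sigma-algebra. *)
Lemma sigma_upto_one_point (D : set nat) (Xt : nat -> R -> X) :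
  sigma_upto Xt D `<=` [set E | E = set0 \/ E = setT].
Proof.
apply: smallest_sub.
  split; first by left.
    by move=> E [->|->]; rewrite setTD ?setC0 ?setCT; [right|left].
  move=> F FE; have [[n Fn]|nF] := pselect (exists n, F n = setT).
    by right; apply/seteqP; split => // w _; exists n => //; rewrite Fn.
  left; rewrite bigcup0// => n _; case: (FE n) => // Fn.
  by case: nF; exists n.
move=> _ [t _ [B _ <-]]; rewrite setTI.
have [Bp|nBp] := pselect (B point); [right|left]; apply/seteqP; split => w //=.
  by rewrite (X1 (Xt t w) point).
by rewrite (X1 (Xt t w) point).
Qed.

Lemma one_point_markov : is_markov_chain one_point_kernel
  (fun=> U01 : probability (measurableTypeR R) R) (fun _ _ => point).
Proof.
split=> [t|x|x t E B /sigma_upto_one_point triv mB].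
- exact: measurable_cst.
- by apply: aeW => w; exact: X1.
have mE : measurable E by case: triv => ->.
have KB : one_point_kernel (point : X) B = (point \in B)%:R%:E.
  by apply: diracE.
transitivity ((point \in B)%:R%:E * U01 E)%E; last first.
  by rewrite integral_cst//; congr (_ * _)%E; exact/esym/KB.
have [Bp|nBp] := pselect (B point).
  rewrite (_ : _ @^-1` _ = setT); last by apply/seteqP; split.
  by rewrite setIT mem_set// mul1e.
rewrite (_ : _ @^-1` _ = set0); last by apply/seteqP; split.
by rewrite setI0 measure0 memNset// mul0e.
Qed.

Definition noise_of (b : bool) (t : nat) : R -> R :=
  noise (pickle (Some (b, t))).

Lemma one_point_randomized_chain : randomized_chain one_point_kernel
  (fun=> U01 : probability (measurableTypeR R) R) (fun _ _ => point)
  (noise_of false) (noise_of true).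
Proof.
split=> [|t|t|x].
- exact: one_point_markov.
- by split=> [|x A mA]; [exact: measurable_noise|exact: noise_law].
- by split=> [|x A mA]; [exact: measurable_noise|exact: noise_law].
apply: mutually_independent_iid_uniform => -[[[] t]|] /=.
- exact: noise_preimage_sub.
- exact: noise_preimage_sub.
(* Trivial events are preimages under any variable, in particular the one of index [pickle None]. *)
- move=> E /sigma_upto_one_point [->|->]; [exists set0|exists setT] => //.
    by rewrite setTI preimage_set0.
  by rewrite setTI preimage_setT.
Qed.

End one_point_chain.

Theorem proposition3p18 (R : realType) :
  exists (X : completePseudoMetricType R)
    (Pi : R.-pker (borel X) ~> (borel X))
    (leader follower : player R X)
    (d : measure_display) (Omega : measurableType d)
    (P : X -> probability Omega R)
    (Xt : nat -> Omega -> X) (Y Y' : nat -> Omega -> R),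
    [/\ polish X,
        has_densities Pi,
        admissible_player leader,
        admissible_player follower &
        randomized_chain Pi P Xt Y Y'] /\
    ~ exists p : X -> R,
        randomized_exact_equilibrium Pi P Xt Y Y' leader follower p.
Proof.
(* Row vectors of length 0 form a one-point complete metric space. *)
pose X : completePseudoMetricType R := 'rV[R]_0.
have X1 (x y : X) : x = y by rewrite [x]thinmx0 [y]thinmx0.
exists X, (one_point_kernel R X), (leader0 R X), (follower0 R X).
exists _, (measurableTypeR R), (fun=> uniform_prob (@ltr01 R)).
exists (fun _ _ => point), (@noise_of R false), (@noise_of R true).
have half01 : 0 < (2^-1 : R) < 1 by lra.
split; last first.
  move=> [p]; apply: no_equilibrium => //.
  - by move=> t; exact: measurable_noise.
  - by move=> t w; exact: noise01.
  - by move=> t w; exact: noise01.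
  - move=> x q q01; have : (0 < uniform_prob (@ltr01 R) `]-oo, q[)%E.
      by rewrite uniform_prob01_lt clamp01_id ?lte_fin; lra.
    by rewrite -(noise_law (pickle (Some (false, 0%N)))).
split.
- split; first by move=> x y _; exact: X1.
  exists setT; last by move=> O [x Ox] _; exists x.
  apply: (@sub_countable _ _ _ [set (point : X)]); last exact: countable1.
  by apply: subset_card_le => x _; exact: X1.
- exact: one_point_has_densities.
- by split => //=; exact: subsingleton_bounded_borel.
- by split => //=; exact: subsingleton_bounded_borel.
- exact: one_point_randomized_chain.
Qed.
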